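(* There is a finitely generated residually finite torsion-free group $G$ that persistently contains Promislow's group $P = \langle x,y \mid x^{-1}y^2xy^2,\ y^{-1}x^2yx^2 \rangle$. That is, there is a finitely generated, residually finite, torsion-free group $G$ such that every finite index subgroup $G'\subset G$ has a subgroup $H\subset G'$ with $H\cong P$.
   Context: Let $P$ be a group. A group $G$ persistently contains $P$ if for every finite index subgroup $G'\subset G$ there is a subgroup $H\subset G'$ with $H\cong P$. Promislow's group is the group with presentation $\langle x,y \mid x^{-1}y^2xy^2,\ y^{-1}x^2yx^2 \rangle$. *)

(* Defs.v *)
From HB Require Import structures.
From mathcomp Require Import all_boot all_fingroup generic_quotient.
From mathcomp Require Import boolp classical_sets functions cardinality.

Set Implicit Arguments.
Unset Strict Implicit.
Unset Printing Implicit Defensive.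

Local Open Scope quotient_scope.
Local Open Scope group_scope.
Local Open Scope classical_set_scope.

Section Presentation.
Variables (X : choiceType) (R : set (seq (X * bool))).

(* The letter (x, true) stands for x and (x, false) for x^-1, so a word in    *)
(* the generators X and their formal inverses is a sequence of letters.       *)
Let word := seq (X * bool).

Definition letter_inv (a : X * bool) : X * bool := (a.1, ~~ a.2).

Definition word_inv (w : word) : word := rev (map letter_inv w).

(* The smallest congruence on words that makes the letters x and x^-1         *)
(* mutually inverse and every relator of R trivial.                           *)
Inductive pres_eq : word -> word -> Prop :=
| PresCancel a : pres_eq [:: a; letter_inv a] [::]
| PresRelator r : R r -> pres_eq r [::]
| PresCat u u' v v' : pres_eq u u' -> pres_eq v v' ->
    pres_eq (u ++ v) (u' ++ v')
| PresRefl w : pres_eq w w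
| PresSym u v : pres_eq u v -> pres_eq v u
| PresTrans u v w : pres_eq u v -> pres_eq v w -> pres_eq u w.

Definition pres_rel : rel word := fun u v => `[< pres_eq u v >].

Lemma pres_rel_refl : reflexive pres_rel.
Proof. by move=> w; apply/asboolP; apply: PresRefl. Qed.

Lemma pres_rel_sym : symmetric pres_rel.
Proof. by move=> u v; apply/asboolP/asboolP; apply: PresSym. Qed.

Lemma pres_rel_trans : transitive pres_rel.
Proof.
by move=> v u w /asboolP uv /asboolP vw; apply/asboolP; apply: PresTrans vw.
Qed.

Canonical pres_equiv :=
  EquivRel pres_rel pres_rel_refl pres_rel_sym pres_rel_trans.

(* The group with presentation < X | R >. *)
Definition presented : Type := {eq_quot pres_equiv}.

HB.instance Definition _ := Choice.on presented.
HB.instance Definition _ := Quotient.on presented.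

Definition pres_class (w : word) : presented := \pi_presented w.

Lemma pres_classP u v : pres_class u = pres_class v <-> pres_eq u v.
Proof.
split=> [/eqmodP/asboolP // | uv].
by apply/eqmodP/asboolP.
Qed.

Lemma repr_pres_class w : pres_eq (repr (pres_class w)) w.
Proof. by apply/pres_classP; rewrite /pres_class reprK. Qed.

Lemma pres_class_repr (g : presented) : pres_class (repr g) = g.
Proof. exact: reprK. Qed.

Definition pres_one : presented := pres_class [::].
Definition pres_mul (g h : presented) : presented :=
  pres_class (repr g ++ repr h).
Definition pres_inv (g : presented) : presented :=
  pres_class (word_inv (repr g)).

Lemma letter_invK : involutive letter_inv.
Proof. by case=> x b; rewrite /letter_inv /= negbK. Qed.

Lemma word_invK : involutive word_inv.
Proof.
by move=> w; rewrite /word_inv map_rev revK -map_comp map_id_in // => a _;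
   apply: letter_invK.
Qed.

Lemma pres_eq_mulV w : pres_eq (w ++ word_inv w) [::].
Proof.
elim: w => [|a w IHw]; first exact: PresRefl.
have -> : (a :: w) ++ word_inv (a :: w)
    = [:: a] ++ ((w ++ word_inv w) ++ [:: letter_inv a]).
  by rewrite /word_inv /= rev_cons -cats1 -catA.
apply: PresTrans (PresCancel a).
apply: (@PresCat [:: a] [:: a] _ [:: letter_inv a]); first exact: PresRefl.
by apply: (@PresCat _ [::] _ [:: letter_inv a]) => //; apply: PresRefl.
Qed.

Lemma pres_mulA : associative pres_mul.
Proof.
move=> f g h; apply/pres_classP.
apply: (@PresTrans _ (repr f ++ repr g ++ repr h)).
  by apply: PresCat; [apply: PresRefl | apply: repr_pres_class].
rewrite catA; apply: PresSym.
by apply: PresCat; [apply: repr_pres_class | apply: PresRefl].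
Qed.

Lemma pres_mul1 : right_id pres_one pres_mul.
Proof.
move=> g; rewrite -[RHS]pres_class_repr; apply/pres_classP.
rewrite -[X in pres_eq _ X]cats0.
by apply: PresCat; [apply: PresRefl | apply: repr_pres_class].
Qed.

Lemma pres_1mul : left_id pres_one pres_mul.
Proof.
move=> g; rewrite -[RHS]pres_class_repr; apply/pres_classP.
rewrite -[X in pres_eq _ X]cat0s.
by apply: PresCat; [apply: repr_pres_class | apply: PresRefl].
Qed.

Lemma pres_mulV : right_inverse pres_one pres_inv pres_mul.
Proof.
move=> g; apply/pres_classP; apply: PresTrans (pres_eq_mulV (repr g)).
by apply: PresCat; [apply: PresRefl | apply: repr_pres_class].
Qed.

Lemma pres_Vmul : left_inverse pres_one pres_inv pres_mul.
Proof.
move=> g; apply/pres_classP.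
apply: PresTrans (pres_eq_mulV (word_inv (repr g))).
rewrite word_invK.
by apply: PresCat; [apply: repr_pres_class | apply: PresRefl].
Qed.

HB.instance Definition _ := isGroup.Build presented
  pres_mulA pres_1mul pres_mul1 pres_Vmul pres_mulV.

End Presentation.

(* The generators x and y are encoded by true and false. *)
Definition promislow_relators : set (seq (bool * bool)) :=
  let x := (true, true) in let xV := letter_inv x in
  let y := (false, true) in let yV := letter_inv y in
  [set [:: xV; y; y; x; y; y]; [:: yV; x; x; y; x; x]].

Definition promislow : groupType := presented promislow_relators.

Definition subgroup (G : groupType) (H : set G) : Prop := group_closed (mem H).

Definition finite_index (G : groupType) (H : set G) : Prop :=
  finite_set (range (fun g : G => [set g * h | h in H])).

Definition finitely_generated (G : groupType) : Prop :=
  exists2 S : set G, finite_set S & smallest (@subgroup G) S = [set: G].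

Definition residually_finite (G : groupType) : Prop :=
  forall g : G, g <> 1 ->
    exists (Q : finGroupType) (f : {multiplicative G -> Q}), f g <> 1.

Definition torsion_free (G : groupType) : Prop :=
  forall (g : G) (n : nat), (0 < n)%N -> g ^+ n = 1 -> g = 1.

Definition iso_subgroup (P G : groupType) (H : set G) : Prop :=
  exists f : {multiplicative P -> G}, set_bij [set: P] H f.

Definition persistently_contains (P G : groupType) : Prop :=
  forall G' : set G, subgroup G' -> finite_index G' ->
    exists H : set G, [/\ subgroup H, H `<=` G' & iso_subgroup P H].

(* Main.v *)
Require Import Defs.
From HB Require Import structures.
From mathcomp Require Import all_boot all_fingroup all_algebra generic_quotient.
From mathcomp Require Import boolp classical_sets functions cardinality.
From mathcomp Require Import zify.

Set Implicit Arguments.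
Unset Strict Implicit.
Unset Printing Implicit Defensive.

Local Open Scope group_scope.
Local Open Scope classical_set_scope.

(** Write P for Promislow's group, with generators x and y.

    The group G is a residually finite relative of the wreath product of P
    with the integers.  Let W be the group of pairs (f, d), where d is an
    integer and f assigns an element of P to each point of each of the cycles
    Z/2, Z/3, Z/4, ..., with d acting by rotating all the cycles by d steps
    ([wreath]).  G is the subgroup of W generated by three elements: the
    rotation by one step, and, for a = x and for a = y, the function with the
    value a at the origin of every cycle and the value 1 elsewhere.
    W is torsion-free because P and the integers are.  It is residually finite
    because P is, each cycle being finite; this is where the cycles do better
    than a single copy of the integers, for which the wreath product with a
    non-abelian group is never residually finite.

    Conjugating by the k-th power of the rotation moves the origin to k, which
    gives elements u_k (from x) and v_k (from y) of G.  If K has finite index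
    in G, the pigeonhole principle provides j <> k such that u_j and u_k lie in
    the same left coset of K, and so do v_j and v_k
    ([finite_index_collision]).  Then K contains u_j^-1 u_k and v_j^-1 v_k.  On
    a cycle where j and k are different points the first of these has the value
    x^-1 at j and x at k, the second has y^-1 at j and y at k; on the other
    cycles both are trivial.  The relations of P are such that x -> x^-1,
    y -> y^-1 extends to an endomorphism ([promislow_inversion]), so
    g |-> (image of g at j, g at k) is a homomorphism of P into W
    ([two_point]), and it is injective since some cycle separates j from k.
    Its image is the subgroup generated by the two elements above, and
    therefore a copy of P in K.  The argument applies to every finitely
    generated, residually finite, torsion-free group that has an endomorphism
    inverting each generator ([inverting_endomorphism_persistent]).

    It remains to see that P is torsion-free and residually finite.  P is the
    Hantzsche-Wendt crystallographic group.  It acts on the integral points of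
    three-space, each coordinate giving a homomorphism to the infinite dihedral
    group.  A normal form computed from the relations shows that every
    nontrivial element acts on some coordinate as a nonzero translation
    ([promislow_detect]), and both properties follow at once, since a nonzero
    translation has infinite order and survives modulo a large integer. *)

(** * Homomorphisms and subgroups *)

Section Homomorphisms.
Variables (G H : groupType) (f : {multiplicative G -> H}).

Lemma hom1 : f 1 = 1.
Proof. by apply: (mulgI (f 1)); rewrite -gmulfM !mulg1. Qed.

Lemma homV g : f g^-1 = (f g)^-1.
Proof. by apply/esym/mulg1_eq; rewrite -gmulfM mulgV hom1. Qed.

Lemma homX g n : f (g ^+ n) = f g ^+ n.
Proof. by elim: n => [|n IHn]; rewrite ?hom1 // !expgS gmulfM IHn. Qed.

Lemma hom_inj : (forall g, f g = 1 -> g = 1) -> injective f.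
Proof.
by move=> fI g h fgh; apply/divg1_eq/fI; rewrite gmulfM homV fgh mulgV.
Qed.
End Homomorphisms.

Definition make_hom (G H : groupType) (f : G -> H)
    (fM : {morph f : g h / g * h}) : {multiplicative G -> H} :=
  HB.pack f (isMultiplicative.Build G H f fM).

Section Subgroups.
Variable G : groupType.
Implicit Type C : set G.

Lemma subgroupP C :
  subgroup C <-> [/\ C 1, (forall g h, C g -> C h -> C (g * h))
                   & (forall g, C g -> C g^-1)].
Proof.
split=> [CG|[C1 CM CV]].
  have [C1 _] := CG; split; first exact: set_mem C1.
    by move=> g h Cg Ch; apply/set_mem/(group_closedM CG); apply: mem_set.
  by move=> g Cg; apply/set_mem/(group_closedV CG); apply: mem_set.
split; first exact: mem_set.
by move=> g h /set_mem Cg /set_mem Ch; apply/mem_set/CM => //; apply: CV.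
Qed.
End Subgroups.

(** * Presented groups *)

Section PresentedGroups.
Variables (X : choiceType) (R : set (seq (X * bool))).
Local Notation word := (seq (X * bool)).

Definition pres_gen (a : X) : presented R := pres_class R [:: (a, true)].

Section WordValue.
Variables (H : groupType) (e : X -> H).

Definition word_val (w : word) : H :=
  \prod_(a <- w) (if a.2 then e a.1 else (e a.1)^-1).

Lemma word_val_cat v w : word_val (v ++ w) = word_val v * word_val w.
Proof. by rewrite /word_val big_cat. Qed.

Lemma word_val_pres_eq : (forall r, R r -> word_val r = 1) ->
  forall v w, pres_eq R v w -> word_val v = word_val w.
Proof.
move=> eR v w; elim=> {v w} //.
- case=> x b; rewrite /word_val big_cons big_seq1 big_nil.
  by case: b; rewrite /= ?mulgV ?mulVg.
- by move=> r /eR ->; rewrite /word_val big_nil.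
- by move=> u u' v v' _ uu' _ vv'; rewrite !word_val_cat uu' vv'.
- by move=> u v w _ -> _ ->.
Qed.
End WordValue.

Lemma pres_class_cat v w :
  pres_class R (v ++ w) = pres_class R v * pres_class R w.
Proof.
by apply/pres_classP/PresSym; apply: PresCat; apply: repr_pres_class.
Qed.

Lemma pres_class_val w : pres_class R w = word_val pres_gen w.
Proof.
elim: w => [|[x b] w IHw]; first by rewrite /word_val big_nil.
rewrite -cat1s pres_class_cat IHw word_val_cat; congr (_ * _).
rewrite /word_val big_seq1; case: b => //=.
apply/esym/mulg1_eq; rewrite -pres_class_cat.
by apply/pres_classP/(PresCancel R (x, true)).
Qed.

Lemma presented_lift (H : groupType) (e : X -> H) :
    (forall r, R r -> word_val e r = 1) ->
  exists f : {multiplicative presented R -> H}, forall a, f (pres_gen a) = e a.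
Proof.
move=> eR; pose f (g : presented R) := word_val e (repr g).
have fC w : f (pres_class R w) = word_val e w.
  exact/(word_val_pres_eq eR)/repr_pres_class.
have fM : {morph f : g h / g * h}.
  move=> g h; rewrite -(pres_class_repr g) -(pres_class_repr h).
  by rewrite -pres_class_cat !fC word_val_cat.
exists (make_hom fM) => a.
by rewrite /= fC /word_val big_seq1.
Qed.

Lemma hom_pres_class (H : groupType) (f : {multiplicative presented R -> H}) w :
  f (pres_class R w) = word_val (f \o pres_gen) w.
Proof.
rewrite pres_class_val /word_val (big_morph f (@gmulfM _ _ f) (hom1 f)).
by apply: eq_bigr => -[a []] _ //=; rewrite homV.
Qed.

Lemma eq_presented_hom (H : groupType) (f f' : {multiplicative presented R -> H}) :
  (forall a, f (pres_gen a) = f' (pres_gen a)) -> f =1 f'.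
Proof.
move=> ff' g; rewrite -(pres_class_repr g) !hom_pres_class.
by apply: eq_bigr => -[a b] _ /=; rewrite ff'.
Qed.

Lemma presented_ind (C : set (presented R)) :
  subgroup C -> (forall a, C (pres_gen a)) -> forall g, C g.
Proof.
move=> /subgroupP[C1 CM CV] Cgen g.
rewrite -(pres_class_repr g) pres_class_val /word_val.
by apply: (big_ind C) => // -[a []] _ //=; apply: CV.
Qed.
End PresentedGroups.

Lemma presented_finitely_generated (X : finType) (R : set (seq (X * bool))) :
  finitely_generated (presented R).
Proof.
exists (range (@pres_gen _ R)); first exact/finite_image/finite_finset.
apply/seteqP; split=> // g _ C [CG genC].
by apply: presented_ind CG _ g => a; apply: genC; exists a.
Qed.

Section GeneratedSubgroup.
Variables (X : choiceType) (H : groupType) (e : X -> H).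

(** The subgroup of H generated by the family e, realized as the group presented
    by all the relations that hold in H.  In this form finite generation is
    immediate, and membership questions become equations in H. *)
Definition generated_by : groupType :=
  presented [set w : seq (X * bool) | word_val e w = 1].

Lemma generated_by_embedding : exists f : {multiplicative generated_by -> H},
  injective f /\ forall a, f (pres_gen _ a) = e a.
Proof.
have [f fE] := @presented_lift _ [set w | word_val e w = 1] _ e (fun _ => id).
exists f; split=> //; apply: hom_inj => g.
rewrite -(pres_class_repr g) hom_pres_class => fg1.
apply/pres_classP/PresRelator; rewrite /= -[RHS]fg1.
by apply: eq_bigr => -[a b] _ /=; rewrite fE.
Qed.
End GeneratedSubgroup.

(** A homomorphism from a presented group factors through an embedding as soon
    as the generators land in its image. *)
Lemma presented_lift_through (X : choiceType) (R : set (seq (X * bool)))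
    (G H : groupType) (f : {multiplicative G -> H})
    (h : {multiplicative presented R -> H}) (e : X -> G) :
  injective f -> (forall a, f (e a) = h (pres_gen R a)) ->
  exists k : {multiplicative presented R -> G},
    (forall a, k (pres_gen R a) = e a) /\ (forall g, f (k g) = h g).
Proof.
move=> f_inj fe.
have [r Rr|k kE] := @presented_lift _ R _ e; last first.
  exists k; split=> // g.
  have fkM : {morph f \o k : x y / x * y} by move=> x y; rewrite /= !gmulfM.
  pose fk := make_hom fkM.
  apply: (@eq_presented_hom _ _ _ fk h) => a.
  by rewrite /= kE fe.
apply: f_inj; rewrite hom1 /word_val (big_morph f (@gmulfM _ _ f) (hom1 f)).
transitivity (h (pres_class R r)).
  by rewrite hom_pres_class; apply: eq_bigr => -[a []] _ /=; rewrite ?homV fe.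
by have /pres_classP-> := PresRelator Rr; rewrite -[RHS](hom1 h).
Qed.

(** * Residual finiteness and torsion *)

Lemma residually_finite_action (G : groupType) :
    (forall g : G, g <> 1 -> exists (S : finType) (act : G -> S -> S),
      [/\ act 1 =1 id, forall g h, act (g * h) =1 act g \o act h
        & exists s, act g s <> s]) ->
  residually_finite G.
Proof.
move=> ract g /ract[S [act [act1 actM [s gs]]]].
have actK h : cancel (act h) (act h^-1).
  by move=> t; rewrite -[LHS]actM mulVg act1.
(* Permutations compose from left to right, so a left action becomes a
   homomorphism after inversion. *)
pose f (h : G) : {perm S} := perm (can_inj (actK h^-1)).
have fM : {morph f : h k / h * k}.
  by move=> h k; apply/permP => t; rewrite permM !permE invgM actM.
pose fhom := HB.pack_for {multiplicative G -> {perm S}} f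
  (isMultiplicative.Build G {perm S} f fM).
exists {perm S}, fhom => /permP/(_ (act g s)).
by rewrite /= permE perm1 actK => /esym.
Qed.

Lemma torsion_free_embedding (G H : groupType) (f : {multiplicative G -> H}) :
  injective f -> torsion_free H -> torsion_free G.
Proof.
move=> f_inj Htf g n n0 gn1; apply: f_inj; rewrite hom1.
by apply: Htf n0 _; rewrite -homX gn1 hom1.
Qed.

Lemma residually_finite_embedding (G H : groupType) (f : {multiplicative G -> H}) :
  injective f -> residually_finite H -> residually_finite G.
Proof.
move=> f_inj Hrf g g1.
have [|Q [q qfg]] := Hrf (f g); first by rewrite -(hom1 f) => /f_inj.
by exists Q, (q \o f).
Qed.

(** * Integer powers *)

Section IntegerPowers.
Variable G : groupType.
Implicit Types (g h : G) (a b : int).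

Definition zpow g a : G :=
  match a with Posz n => g ^+ n | Negz n => g ^- n.+1 end.

Lemma zpowS g a : zpow g (a + 1)%R = g * zpow g a.
Proof.
case: a => n; first by rewrite -PoszD addn1 /= expgS.
have -> : (Negz n + 1)%R = (- n%:Z)%R by lia.
case: n => [|n] /=; first by rewrite expg1 mulgV.
by rewrite /= [g ^+ n.+2]expgSr invgM mulVKg.
Qed.

Lemma zpowD g a b : zpow g (a + b)%R = zpow g a * zpow g b.
Proof.
elim/int_ind: a => [|n IHn|n IHn]; first by rewrite GRing.add0r mul1g.
  have -> : (n.+1%:Z + b)%R = (n%:Z + b + 1)%R by lia.
  have -> : Posz n.+1 = (n%:Z + 1)%R by lia.
  by rewrite !zpowS IHn mulgA.
apply: (mulgI g); rewrite mulgA -!zpowS.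
have -> : (- n.+1%:Z + b + 1)%R = (- n%:Z + b)%R by lia.
by have -> : (- n.+1%:Z + 1)%R = (- n%:Z)%R by lia.
Qed.

Lemma zpowN g a : zpow g (- a)%R = (zpow g a)^-1.
Proof. by apply/esym/mulg1_eq; rewrite -zpowD GRing.subrr. Qed.

Lemma zpowV g a : zpow g^-1 a = zpow g (- a)%R.
Proof. by rewrite zpowN; case: a => n /=; rewrite expVgn ?invgK. Qed.

Lemma commute_zpow g h a : commute g h -> commute g (zpow h a).
Proof.
by move=> gh; case: a => n; [|apply: commuteV]; apply: commuteX.
Qed.

Lemma zpow_conj g h k a : g * h = k * g -> g * zpow h a = zpow k a * g.
Proof.
move=> ghk; have -> : k = h ^ g^-1 by rewrite /conjg invgK mulgA ghk mulgK.
have -> : zpow (h ^ g^-1) a = zpow h a ^ g^-1.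
  by case: a => n /=; rewrite -conjXg ?conjVg.
by rewrite /conjg invgK mulgA mulgVK.
Qed.

Lemma invert_twice g h : g * h = h^-1 * g -> commute (g * g) h.
Proof.
move=> gh; have := zpow_conj (-1)%R gh; rewrite zpowV /= expg1 => ghV.
by rewrite /commute -mulgA gh mulgA ghV mulgA.
Qed.
End IntegerPowers.

Lemma hom_zpow (G H : groupType) (f : {multiplicative G -> H}) g a :
  f (zpow g a) = zpow (f g) a.
Proof. by case: a => n /=; rewrite ?homV homX. Qed.

(** * The normal form in Promislow's group *)

(** The two relations say that x inverts y^2 and y inverts x^2.  They make the
    subgroup generated by X = x^2, Y = y^2 and Z = (xy)^2 abelian and normal,
    with 1, x, y, xy representing all its cosets. *)
Section PromislowRelations.
Variables (G : groupType) (x y : G).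
Hypotheses (relx : x^-1 * (y * (y * (x * (y * y)))) = 1)
           (rely : y^-1 * (x * (x * (y * (x * x)))) = 1).

Let X := x * x.
Let Y := y * y.
Let Z := x * y * (x * y).

Lemma mul_x_Y : x * Y = Y^-1 * x.
Proof.
have xE : Y * (x * Y) = x.
  by have /mulg1_eq := relx; rewrite invgK mulgA.
by rewrite -[in RHS]xE mulKg.
Qed.

Lemma mul_y_X : y * X = X^-1 * y.
Proof.
have yE : X * (y * X) = y.
  by have /mulg1_eq := rely; rewrite invgK mulgA.
by rewrite -[in RHS]yE mulKg.
Qed.

Lemma mul_x_X : x * X = X * x. Proof. exact: mulgA. Qed.
Lemma mul_y_Y : y * Y = Y * y. Proof. exact: mulgA. Qed.

Lemma mul_x_invY : x * Y^-1 = Y * x.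
Proof. by have := zpow_conj (-1)%R mul_x_Y; rewrite zpowV. Qed.

Lemma mul_y_invX : y * X^-1 = X * y.
Proof. by have := zpow_conj (-1)%R mul_y_X; rewrite zpowV. Qed.

(** This lemma and the next give the normal forms of the two products of y with
    a coset representative that are not immediate; the exponents are those with
    which both sides act in the same way on points of three-space. *)
Lemma mul_y_x : y * x = X^-1 * Y * Z^-1 * (x * y).
Proof.
have Zxy : Z^-1 * (x * y) = y^-1 * x^-1 by rewrite invgM mulgVK invgM.
rewrite -mulgA Zxy mulgA -(mulgA X^-1) mulgK -mul_y_X -mulgA.
by rewrite mulgK.
Qed.

Lemma mul_y_xy : y * (x * y) = X^-1 * Z^-1 * x.
Proof.
have -> : X^-1 * Z^-1 * x = X^-1 * y^-1 * x^-1 * y^-1.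
  by rewrite !invgM !mulgA mulgVK.
have -> : X^-1 * y^-1 = y^-1 * X.
  by apply: (mulgI y); rewrite !mulgA mul_y_invX mulgK mulgV mul1g.
rewrite -(mulgA y^-1) mulgK.
apply: (mulgI y); rewrite !mulgA -/Y mulgV mul1g -mul_x_invY.
by rewrite /Y invgM mulgA mulgVK.
Qed.

Lemma commute_X_Y : commute X Y. Proof. exact: invert_twice mul_x_Y. Qed.

Lemma commute_Z_X : commute Z X.
Proof.
apply: invert_twice; rewrite -mulgA mul_y_X !mulgA; congr (_ * _).
by apply: commuteV; apply: mul_x_X.
Qed.

Lemma commute_Z_Y : commute Z Y.
Proof. by apply: invert_twice; rewrite -mulgA mul_y_Y !mulgA -(mulgA x) mul_x_Y. Qed.

Lemma mul_x_Z : x * Z = Z^-1 * x.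
Proof.
(* In Z x Z = x, regrouping the left side exposes y X, then Y x, which the
   relations rewrite; everything then cancels. *)
apply: (mulgI Z); rewrite mulVKg.
have -> : Z * (x * Z) = x * y * x * (y * X) * (y * (x * y)).
  by rewrite /Z /X !mulgA.
have -> : x * y * x * (y * X) * (y * (x * y)) = x * y * (x * X^-1) * (Y * x) * y.
  by rewrite mul_y_X /Y !mulgA.
rewrite -mul_x_invY (_ : x * X^-1 = x^-1); last by rewrite invgM mulVKg.
by rewrite [_ * (x * _)]mulgA mulgVK invgM !mulgA mulgK mulgVK.
Qed.

Lemma mul_y_Z : y * Z = Z^-1 * y.
Proof.
apply: (mulgI Z); rewrite mulVKg.
have -> : Z * (y * Z) = x * y * x * (Y * x) * (y * x * y).
  by rewrite /Z /Y !mulgA.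
rewrite -mul_x_invY.
have -> : x * y * x * (x * Y^-1) * (y * x * y) = x * (y * X) * y^-1 * x * y.
  by rewrite /X /Y invgM !mulgA mulgVK.
by rewrite mul_y_X !mulgA mulgK invgM !mulgA mulgV mul1g mulVg mul1g.
Qed.

Definition translation (a b c : int) : G := zpow X a * zpow Y b * zpow Z c.

Lemma translationD a b c a' b' c' :
  translation a b c * translation a' b' c' =
  translation (a + a')%R (b + b')%R (c + c')%R.
Proof.
have XY p q : commute (zpow X p) (zpow Y q).
  by apply: commute_zpow; apply/commute_sym/commute_zpow/commute_sym/commute_X_Y.
have ZX p q : commute (zpow Z p) (zpow X q).
  by apply: commute_zpow; apply/commute_sym/commute_zpow/commute_sym/commute_Z_X.
have ZY p q : commute (zpow Z p) (zpow Y q).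
  by apply: commute_zpow; apply/commute_sym/commute_zpow/commute_sym/commute_Z_Y.
rewrite /translation !zpowD !mulgA -(mulgA _ (zpow Z c) (zpow X a')) ZX mulgA.
rewrite -(mulgA _ (zpow Y b) (zpow X a')) -XY mulgA.
by rewrite -(mulgA _ (zpow Z c) (zpow Y b')) ZY mulgA.
Qed.

Lemma mul_x_translation a b c :
  x * translation a b c = translation a (- b)%R (- c)%R * x.
Proof.
rewrite /translation !mulgA (zpow_conj _ mul_x_X) -(mulgA _ x) (zpow_conj _ mul_x_Y).
by rewrite mulgA -(mulgA _ x) (zpow_conj _ mul_x_Z) mulgA !zpowV.
Qed.

Lemma mul_y_translation a b c :
  y * translation a b c = translation (- a)%R b (- c)%R * y.
Proof.
rewrite /translation !mulgA (zpow_conj _ mul_y_X) -(mulgA _ y) (zpow_conj _ mul_y_Y).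
by rewrite mulgA -(mulgA _ y) (zpow_conj _ mul_y_Z) mulgA !zpowV.
Qed.

(** Closed under left multiplication by x and y, this set is the whole group as
    soon as x and y generate it. *)
Definition normal_form : set G :=
  [set g | exists a b c, exists2 r, r \in [:: 1; x; y; x * y]
                                  & g = translation a b c * r].

Lemma normal_form_translation a b c g :
  normal_form g -> normal_form (translation a b c * g).
Proof.
move=> [a' [b' [c' [r rR ->]]]]; rewrite mulgA translationD.
by do 3 eexists; exists r.
Qed.

Lemma normal_form_coset_rep r : r \in [:: 1; x; y; x * y] -> normal_form r.
Proof.
by move=> rR; exists 0%R, 0%R, 0%R, r; rewrite // /translation !mul1g.
Qed.

Lemma normal_form_x g : normal_form g -> normal_form (x * g).
Proof.
move=> [a [b [c [r rR ->]]]]; rewrite mulgA mul_x_translation -mulgA.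
apply: normal_form_translation; move: rR; rewrite !inE => /or4P[]/eqP->.
- by rewrite mulg1; apply: normal_form_coset_rep; rewrite !inE eqxx orbT.
- rewrite -[x * x]mulg1 -/X.
  have -> : X = translation 1 0 0 by rewrite /translation !mulg1.
  by apply/normal_form_translation/normal_form_coset_rep; rewrite !inE eqxx.
- by apply: normal_form_coset_rep; rewrite !inE eqxx !orbT.
- rewrite mulgA -/X.
  have -> : X = translation 1 0 0 by rewrite /translation !mulg1.
  by apply/normal_form_translation/normal_form_coset_rep; rewrite !inE eqxx !orbT.
Qed.

Lemma normal_form_y g : normal_form g -> normal_form (y * g).
Proof.
move=> [a [b [c [r rR ->]]]]; rewrite mulgA mul_y_translation -mulgA.
apply: normal_form_translation; move: rR; rewrite !inE => /or4P[]/eqP->.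
- by rewrite mulg1; apply: normal_form_coset_rep; rewrite !inE eqxx !orbT.
- have -> : y * x = translation (-1)%R 1 (-1)%R * (x * y).
    by rewrite mul_y_x /translation !zpowN.
  by apply/normal_form_translation/normal_form_coset_rep; rewrite !inE eqxx !orbT.
- rewrite -[y * y]mulg1 -/Y.
  have -> : Y = translation 0 1 0 by rewrite /translation mul1g mulg1.
  by apply/normal_form_translation/normal_form_coset_rep; rewrite !inE eqxx.
- have -> : y * (x * y) = translation (-1)%R 0 (-1)%R * x.
    by rewrite mul_y_xy /translation !zpowN mulg1.
  by apply/normal_form_translation/normal_form_coset_rep; rewrite !inE eqxx !orbT.
Qed.

End PromislowRelations.

(** * Detecting elements of Promislow's group *)

Lemma presented_ind_left (X : choiceType) (R : set (seq (X * bool)))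
    (C : set (presented R)) :
    C 1 -> (forall a g, C g -> C (pres_gen R a * g)) ->
    (forall a g, C g -> C ((pres_gen R a)^-1 * g)) ->
  forall g, C g.
Proof.
move=> C1 CM CV g; rewrite -(pres_class_repr g) pres_class_val /word_val.
by apply: big_rec => // -[a []] h _ /=; [apply: CM | apply: CV].
Qed.

(** The infinite dihedral group: the pair (s, a) is the map z |-> a + z or
    z |-> a - z of the integers, according to whether s is false or true. *)
Definition dihedral : Type := (bool * int)%type.
HB.instance Definition _ := Choice.on dihedral.

Section Dihedral.
Implicit Types p q : dihedral.

Definition signed (R : zmodType) (s : bool) (z : R) : R := if s then (- z)%R else z.

Definition dihedral_one : dihedral := (false, 0%R).
Definition dihedral_mul p q : dihedral :=
  (p.1 (+) q.1, (p.2 + signed p.1 q.2)%R).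
Definition dihedral_inv p : dihedral := (p.1, (- signed p.1 p.2)%R).

Lemma dihedral_mulA : associative dihedral_mul.
Proof.
by move=> [s a] [t b] [u c]; congr pair; rewrite /= ?addbA //;
   case: s; case: t => /=; lia.
Qed.

Lemma dihedral_1mul : left_id dihedral_one dihedral_mul.
Proof. by move=> [s a]; congr pair; rewrite /= GRing.add0r. Qed.

Lemma dihedral_mul1 : right_id dihedral_one dihedral_mul.
Proof. by move=> [[] a]; congr pair; rewrite /= ?GRing.oppr0 GRing.addr0. Qed.

Lemma dihedral_Vmul : left_inverse dihedral_one dihedral_inv dihedral_mul.
Proof. by move=> [[] a]; congr pair; rewrite /=; lia. Qed.

Lemma dihedral_mulV : right_inverse dihedral_one dihedral_inv dihedral_mul.
Proof. by move=> [[] a]; congr pair; rewrite /=; lia. Qed.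

HB.instance Definition _ := isGroup.Build dihedral
  dihedral_mulA dihedral_1mul dihedral_mul1 dihedral_Vmul dihedral_mulV.

Lemma dihedral_translationX (a : int) n :
  ((false, a) : dihedral) ^+ n = (false, a *+ n)%R.
Proof.
elim: n => [//|n IHn]; rewrite expgS IHn GRing.mulrS.
by [].
Qed.

Lemma dihedral_translation_zpow (a b : int) :
  zpow ((false, a) : dihedral) b = (false, b * a)%R.
Proof.
case: b => n; rewrite /zpow dihedral_translationX; congr pair; rewrite /=; lia.
Qed.
End Dihedral.

Definition promislow_x : promislow := pres_gen promislow_relators true.
Definition promislow_y : promislow := pres_gen promislow_relators false.

Lemma promislow_lift (H : groupType) (x y : H) :
    x^-1 * (y * (y * (x * (y * y)))) = 1 ->
    y^-1 * (x * (x * (y * (x * x)))) = 1 ->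
  exists f : {multiplicative promislow -> H}, f promislow_x = x /\ f promislow_y = y.
Proof.
move=> relx rely.
have [r|f fE] := @presented_lift _ promislow_relators H (fun b => if b then x else y).
  by case=> ->; rewrite /word_val !big_cons big_nil /= mulg1.
by exists f; rewrite !fE.
Qed.

Lemma promislow_relation_x (x := promislow_x) (y := promislow_y) :
  x^-1 * (y * (y * (x * (y * y)))) = 1.
Proof.
have : pres_class promislow_relators [:: (true, false); (false, true);
    (false, true); (true, true); (false, true); (false, true)] = 1.
  by apply/pres_classP/PresRelator; left.
by rewrite pres_class_val /word_val !big_cons big_nil /= mulg1.
Qed.

Lemma promislow_relation_y (x := promislow_x) (y := promislow_y) :
  y^-1 * (x * (x * (y * (x * x)))) = 1.
Proof.
have : pres_class promislow_relators [:: (false, false); (true, true);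
    (true, true); (false, true); (true, true); (true, true)] = 1.
  by apply/pres_classP/PresRelator; right.
by rewrite pres_class_val /word_val !big_cons big_nil /= mulg1.
Qed.

Lemma promislow_normal_form g : normal_form promislow_x promislow_y g.
Proof.
set x := promislow_x; set y := promislow_y.
have rx := promislow_relation_x; have ry := promislow_relation_y.
have nfx := normal_form_x rx ry; have nfy := normal_form_y rx ry.
apply: presented_ind_left => [|[] h|[] h] //.
- by apply: normal_form_coset_rep; rewrite inE eqxx.
- exact: nfx.
- exact: nfy.
- move=> nh; rewrite (_ : _ * h = x * (translation x y (-1)%R 0 0 * h)).
    exact/nfx/(normal_form_translation rx ry).
  by rewrite /translation !mulg1 zpowN /= invgM !mulgA mulgV mul1g.
- move=> nh; rewrite (_ : _ * h = y * (translation x y 0 (-1)%R 0 * h)).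
    exact/nfy/(normal_form_translation rx ry).
  by rewrite /translation mul1g mulg1 zpowN /= invgM !mulgA mulgV mul1g.
Qed.

(** Let x and y act on integral points by
    (a, b, c) |-> (a + 1, 1 - b, - c) and (a, b, c) |-> (- a, b + 1, 1 - c).
    The three homomorphisms below are the three coordinates of this action.  On
    the coset of x the first coordinate moves by an odd integer, on the coset of
    y the second one does, and on the coset of xy the third one. *)
Lemma promislow_detect g : g <> 1 ->
  exists (f : {multiplicative promislow -> dihedral}) (v : int),
    v != 0%R /\ f g = (false, v).
Proof.
have [f1 [f1x f1y]] := @promislow_lift dihedral (false, 1%R) (true, 0%R) erefl erefl.
have [f2 [f2x f2y]] := @promislow_lift dihedral (true, 1%R) (false, 1%R) erefl erefl.
have [f3 [f3x f3y]] := @promislow_lift dihedral (true, 0%R) (true, 1%R) erefl erefl.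
have [a [b [c [r rR ->]]]] := promislow_normal_form g.
have tE (f : {multiplicative promislow -> dihedral}) :
    f (translation promislow_x promislow_y a b c) =
   translation (f promislow_x) (f promislow_y) a b c.
  by rewrite /translation !gmulfM !hom_zpow !gmulfM.
have t1 : f1 (translation promislow_x promislow_y a b c) = (false, a * 2)%R.
  rewrite tE f1x f1y /translation !dihedral_translation_zpow.
  by congr pair; rewrite /=; lia.
have t2 : f2 (translation promislow_x promislow_y a b c) = (false, b * 2)%R.
  rewrite tE f2x f2y /translation !dihedral_translation_zpow.
  by congr pair; rewrite /=; lia.
have t3 : f3 (translation promislow_x promislow_y a b c) = (false, - c * 2)%R.
  rewrite tE f3x f3y /translation !dihedral_translation_zpow.
  by congr pair; rewrite /=; lia.
move: rR; rewrite !inE => /or4P[]/eqP-> g1.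
- have [a0|] := eqVneq a 0%R; last first.
    by exists f1, (a * 2)%R; split; [lia | rewrite mulg1].
  have [b0|] := eqVneq b 0%R; last first.
    by exists f2, (b * 2)%R; split; [lia | rewrite mulg1].
  have [c0|] := eqVneq c 0%R; last first.
    by exists f3, (- c * 2)%R; split; [lia | rewrite mulg1].
  by case: g1; rewrite a0 b0 c0 /translation !mulg1.
- exists f1, (a * 2 + 1)%R; split; first lia.
  by rewrite gmulfM t1 f1x.
- exists f2, (b * 2 + 1)%R; split; first lia.
  by rewrite gmulfM t2 f2y.
- exists f3, (- c * 2 - 1)%R; split; first lia.
  by rewrite gmulfM t3 gmulfM f3x f3y.
Qed.

Lemma promislow_torsion_free : torsion_free promislow.
Proof.
move=> g n n0 gn1; apply: contrapT => /promislow_detect[f [v [v0 fg]]].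
have := homX f g n; rewrite gn1 hom1 fg dihedral_translationX => -[] /esym/eqP.
by rewrite Num.Theory.mulrn_eq0 (gtn_eqF n0) (negPf v0).
Qed.

Lemma intr_Zp_neq0 n (e : int) :
  e != 0%R -> (`|e| < n.+2)%N -> (e%:~R != 0 :> 'I_n.+2)%R.
Proof.
have nz m : (0 < m < n.+2)%N -> (m%:R != 0 :> 'I_n.+2)%R.
  by case/andP=> m0 mn; rewrite Zp_nat -val_eqE /= modn_small // gtn_eqF.
case: e => m e0 en; first by apply: nz; rewrite lt0n en andbT.
by rewrite NegzE mulrNz GRing.oppr_eq0; apply: nz.
Qed.

Lemma promislow_residually_finite : residually_finite promislow.
Proof.
apply: residually_finite_action => g /promislow_detect[f [v [v0 fg]]].
(* The translation by v moves 0 modulo |v| + 2. *)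
pose act (h : promislow) (i : 'I_`|v|.+2) :=
  ((f h).2%:~R + signed (f h).1 i)%R.
exists 'I_`|v|.+2, act; split.
- by move=> i; rewrite /act hom1 GRing.add0r.
- move=> h k i; rewrite /act gmulfM /=.
  case: (f h) (f k) => [s a] [t b]; rewrite /= intrD -GRing.addrA.
  congr (_ + _)%R.
  by case: s; case: t; rewrite /= ?mulrNz ?GRing.opprD ?GRing.opprK.
- by exists 0%R; apply/eqP; rewrite /act fg /= GRing.addr0 intr_Zp_neq0.
Qed.

(** The relators with x and y inverted say that x^-1 inverts y^2 and y^-1
    inverts x^2, which is as true as for x and y. *)
Lemma promislow_inversion : exists f : {multiplicative promislow -> promislow},
  f promislow_x = promislow_x^-1 /\ f promislow_y = promislow_y^-1.
Proof.
have rx := promislow_relation_x; have ry := promislow_relation_y.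
set x := promislow_x in rx ry *; set y := promislow_y in rx ry *.
apply: promislow_lift; rewrite invgK !mulgA.
  by rewrite -(mulgA x) -invgM (mul_x_invY rx) mulgK -mulgA -invgM mulgV.
by rewrite -(mulgA y) -invgM (mul_y_invX ry) mulgK -mulgA -invgM mulgV.
Qed.

(** * The wreath product along all finite cycles *)

Section CyclicWreath.
Variable A : groupType.

(** The cycle Z/(n+2) is 'I_n.+2, so that every cycle carries the ring structure
    into which integers can be cast. *)
Definition wreath : Type := ((forall n, 'I_n.+2 -> A) * int)%type.
HB.instance Definition _ := gen_eqMixin wreath.
HB.instance Definition _ := gen_choiceMixin wreath.
Implicit Types p q : wreath.

Definition wreath_one : wreath := (fun _ _ => 1, 0%R).
Definition wreath_mul p q : wreath :=
  (fun n i => p.1 n i * q.1 n (i - p.2%:~R)%R, (p.2 + q.2)%R).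
Definition wreath_inv p : wreath :=
  (fun n i => (p.1 n (i + p.2%:~R)%R)^-1, (- p.2)%R).

Lemma wreath_eq p q : (forall n i, p.1 n i = q.1 n i) -> p.2 = q.2 -> p = q.
Proof.
case: p q => [f d] [g e] /= fg ->; congr pair.
by apply/functional_extensionality_dep => n; apply/funext => i.
Qed.

Lemma wreath_mulA : associative wreath_mul.
Proof.
move=> p q r; apply: wreath_eq => [n i|] /=; last exact: GRing.addrA.
by rewrite intrD GRing.opprD GRing.addrA mulgA.
Qed.

Lemma wreath_1mul : left_id wreath_one wreath_mul.
Proof.
move=> p; apply: wreath_eq => [n i|] /=; last exact: GRing.add0r.
by rewrite GRing.subr0 mul1g.
Qed.

Lemma wreath_mul1 : right_id wreath_one wreath_mul.
Proof.
by move=> p; apply: wreath_eq => [n i|] /=; [apply: mulg1 | apply: GRing.addr0].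
Qed.

Lemma wreath_Vmul : left_inverse wreath_one wreath_inv wreath_mul.
Proof.
move=> p; apply: wreath_eq => [n i|] /=; last exact: GRing.addNr.
by rewrite mulrNz GRing.opprK mulVg.
Qed.

Lemma wreath_mulV : right_inverse wreath_one wreath_inv wreath_mul.
Proof.
move=> p; apply: wreath_eq => [n i|] /=; last exact: GRing.subrr.
by rewrite GRing.subrK mulgV.
Qed.

HB.instance Definition _ := isGroup.Build wreath
  wreath_mulA wreath_1mul wreath_mul1 wreath_Vmul wreath_mulV.

Lemma wreathM1 p q n i : (p * q).1 n i = p.1 n i * q.1 n (i - p.2%:~R)%R.
Proof. by []. Qed.

Lemma wreathX2 p n : (p ^+ n).2 = (p.2 *+ n)%R.
Proof. by elim: n => // n IHn; rewrite expgS GRing.mulrS -IHn. Qed.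

Lemma wreathX1 p n m i : p.2 = 0%R -> (p ^+ n).1 m i = p.1 m i ^+ n.
Proof.
move=> p0; elim: n => // n IHn.
by rewrite !expgS wreathM1 p0 GRing.subr0 IHn.
Qed.

Lemma wreath_torsion_free : torsion_free A -> torsion_free wreath.
Proof.
move=> Atf p n n0 pn1.
have p0 : p.2 = 0%R.
  have /eqP := wreathX2 p n; rewrite pn1 eq_sym Num.Theory.mulrn_eq0 gtn_eqF //=.
  by move/eqP.
apply: wreath_eq => // m i; apply: (Atf _ n) => //.
by rewrite -wreathX1 // pn1.
Qed.

Lemma wreath_residually_finite : residually_finite A -> residually_finite wreath.
Proof.
move=> Arf; apply: residually_finite_action => p p1.
have [p0|p0] := eqVneq p.2 0%R; last first.
  (* A rotation by d <> 0 steps moves the cycle of length |d| + 2. *)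
  exists 'I_`|p.2|.+2, (fun q i => q.2%:~R + i)%R; split.
  - by move=> i; rewrite GRing.add0r.
  - by move=> q r i; rewrite /= intrD GRing.addrA.
  - by exists 0%R; apply/eqP; rewrite GRing.addr0 intr_Zp_neq0.
have [n [i pni]] : exists n i, p.1 n i <> 1.
  apply: contrapT => none; apply: p1; apply: wreath_eq => // n i.
  by apply: contrapT => pni; apply: none; exists n, i.
(* Q detects the value p.1 n i, and W acts on the copies of Q placed along the
   cycle of length n + 2, rotating them and multiplying in each of them. *)
have [Q [f fp]] := Arf _ pni.
exists (Q * 'I_n.+2)%type,
  (fun q (s : Q * 'I_n.+2) =>
     (f (q.1 n (s.2 + q.2%:~R)%R) * s.1, (s.2 + q.2%:~R)%R)); split.
- by move=> [a j]; rewrite /= GRing.addr0 hom1 mul1g.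
- move=> q r [a j] /=; rewrite gmulfM intrD; congr pair; last first.
    by rewrite -GRing.addrA (GRing.addrC r.2%:~R)%R.
  rewrite -mulgA (GRing.addrC q.2%:~R)%R !GRing.addrA.
  congr (_ * (f (r.1 n _) * _)).
  by rewrite GRing.addrK.
- exists (1, i) => /=; rewrite p0 GRing.addr0 mulg1 => -[].
  exact: fp.
Qed.
End CyclicWreath.

Section PointMasses.
Variable A : groupType.

Definition shift : wreath A := (fun _ _ => 1, 1%R).

Definition point (k : nat) (a : A) : wreath A :=
  (fun n i => if i == k%:R%R then a else 1, 0%R).

Lemma shiftX k : shift ^+ k = ((fun _ _ => 1), k%:R%R) :> wreath A.
Proof.
apply: wreath_eq => [n i|] /=; last by rewrite wreathX2.
by elim: k i => // k IHk i; rewrite expgS wreathM1 IHk mul1g.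
Qed.

Lemma shift_point k a : shift ^+ k * point 0 a * (shift ^+ k)^-1 = point k a.
Proof.
rewrite shiftX; apply: wreath_eq => [n i|] /=.
  by rewrite mul1g invg1 mulg1 GRing.subr_eq0 natz.
by rewrite GRing.addr0 GRing.subrr.
Qed.

(** The value f g at the point j and g at the point k of each cycle.  On the
    cycles where j and k coincide the value is 1, as it is for the product
    (point j a)^-1 * point k a. *)
Definition two_point (f : {multiplicative A -> A}) (j k : nat) (g : A) :
    wreath A :=
  (fun n i => if i == j%:R%R then if i == k%:R%R then 1 else f g
              else if i == k%:R%R then g else 1, 0%R).

Lemma two_pointM f j k : {morph two_point f j k : g h / g * h}.
Proof.
move=> g h; apply: wreath_eq => [n i|] //=.
by rewrite GRing.subr0; do 2 case: (i == _); rewrite ?gmulfM ?mulg1.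
Qed.

Lemma two_point_inj f j k : j <> k -> injective (two_point f j k).
Proof.
(* The cycle of length j + k + 2 separates j from k. *)
move=> jk g h [] /(congr1 (fun F => F (j + k) k%:R%R)) /=.
rewrite eqxx [_ == _ :> 'I_ _](_ : _ = false) //.
apply/negbTE; rewrite -GRing.subr_eq0.
have -> : (k%:R - j%:R = (k%:Z - j%:Z)%:~R :> 'I_(j + k).+2)%R by rewrite intrB.
by apply: intr_Zp_neq0; lia.
Qed.

Lemma point_div (f : {multiplicative A -> A}) j k a : f a = a^-1 ->
  (point j a)^-1 * point k a = two_point f j k a.
Proof.
move=> fa; apply: wreath_eq => [n i|] //=.
rewrite GRing.addr0 GRing.subr0.
by do 2 case: (i == _); rewrite ?fa ?mulVg ?invg1 ?mulg1 ?mul1g.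
Qed.
End PointMasses.

(** * Persistence *)

(** Infinitely many families of elements, and only finitely many families of
    left cosets. *)
Lemma finite_index_collision (G : groupType) (K : set G) (X : finType)
    (u : nat -> X -> G) :
    subgroup K -> finite_index K ->
  exists j k, j <> k /\ forall a, K ((u j a)^-1 * u k a).
Proof.
move=> /subgroupP[K1 _ _] /finite_seqP[s sE].
pose coset (g : G) : set G := [set g * h | h in K].
have coset_s g : coset g \in s.
  have : range coset (coset g) by exists g.
  by rewrite sE.
pose F k := [ffun a => inord (index (coset (u k a)) s) : 'I_(size s).+1].
apply: contrapT => no_collision.
apply: infinite_nat; rewrite -(preimage_setT F).
apply: finite_preimage finite_finset => j k _ _ /ffunP FE.
apply: contrapT => jk; apply: no_collision; exists j, k; split=> // a.
have := congr1 val (FE a); rewrite !ffunE /=.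
rewrite !inordK ?ltnS ?index_size // => /(congr1 (nth set0 s)).
rewrite !nth_index // => coset_jk.
have : coset (u j a) (u k a) by rewrite coset_jk; exists 1; rewrite ?mulg1.
by case=> h Kh <-; rewrite mulKg.
Qed.

(** Whatever K is, the elements (u j b)^-1 * u k b of K supplied by the
    collision are the images of the generators b under the injective
    homomorphism [two_point inv j k], so they generate a copy of the presented
    group. *)
Lemma inverting_endomorphism_persistent (X : finType)
    (R : set (seq (X * bool))) (inv : {multiplicative presented R -> presented R}) :
    (forall a, inv (pres_gen R a) = (pres_gen R a)^-1) ->
    residually_finite (presented R) -> torsion_free (presented R) ->
  exists G : groupType,
    [/\ finitely_generated G, residually_finite G, torsion_free G
      & persistently_contains (presented R) G].
Proof.
move=> invE Prf Ptf.
pose e (a : option X) : wreath (presented R) :=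
  if a is Some b then point 0 (pres_gen R b) else shift _.
have [f [f_inj fE]] := generated_by_embedding e.
exists (generated_by e); split.
- exact: presented_finitely_generated.
- exact/(residually_finite_embedding f_inj)/wreath_residually_finite.
- exact/(torsion_free_embedding f_inj)/wreath_torsion_free.
move=> K KG finK; pose gen a : generated_by e := pres_gen _ a.
pose u k b := gen None ^+ k * gen (Some b) * (gen None ^+ k)^-1.
have fu k b : f (u k b) = point k (pres_gen R b).
  by rewrite !gmulfM homV !homX !fE shift_point.
have [j [k [jk Ku]]] := finite_index_collision u KG finK.
pose h := make_hom (two_pointM inv j k).
have [b|r [rE fr]] := @presented_lift_through _ R _ _ f h
   (fun b => (u j b)^-1 * u k b) f_inj.
  by rewrite gmulfM homV !fu; apply: point_div.
have r_inj : injective r.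
  move=> g g' rgg'; apply: (@two_point_inj _ inv j k jk).
  by rewrite -[LHS]fr rgg' fr.
exists (range r); split.
- apply/subgroupP; split; first by exists 1; rewrite ?hom1.
    by move=> _ _ [g _ <-] [g' _ <-]; exists (g * g'); rewrite ?gmulfM.
  by move=> _ [g _ <-]; exists g^-1; rewrite ?homV.
- have [K1 KM KV] := (subgroupP K).1 KG.
  move=> _ [g _ <-]; move: g; apply: (@presented_ind _ _ [set g | K (r g)]).
    apply/subgroupP; split=> /= [|g g' Kg Kg'|g Kg]; first by rewrite hom1.
      by rewrite gmulfM; apply: KM.
    by rewrite homV; apply: KV.
  by move=> b /=; rewrite rE.
- by exists r; split=> //; move=> g g' _ _; apply: r_inj.
Qed.

Theorem theorem1p2 :
  exists G : groupType,
    [/\ finitely_generated G, residually_finite G, torsion_free G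
      & persistently_contains promislow G].
Proof.
have [inv [invx invy]] := promislow_inversion.
apply: (@inverting_endomorphism_persistent _ promislow_relators inv).
- by case.
- exact: promislow_residually_finite.
- exact: promislow_torsion_free.
Qed.
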